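(* Let $X$ be a regular topological space such that $X \rightarrow (top\ \omega+1)^{1}_{\omega}$ and $\chi(X) < \mathfrak{b}$. Then $X \rightarrow (top\ \alpha)^{1}_{\omega}$ for all ordinals $\alpha < \omega_{1}$.
   Context: For a topological space $X$, an ordinal $\alpha$ and a cardinal $\kappa$, $X \rightarrow (top\ \alpha)^{1}_{\kappa}$ means: for every function $f: X \to \kappa$ there are $\eta \in \kappa$ and a subset $Y \subseteq f^{-1}[\{\eta\}]$ such that $Y$ (with the subspace topology) is homeomorphic to $\alpha$ with the order topology. $\chi(X)$ is the character of $X$ (the least infinite cardinal $\lambda$ such that each point has a neighbourhood base of size $\le\lambda$). $\mathfrak{b}$ is the bounding number: the least size of a family in $\omega^\omega$ not bounded with respect to eventual domination $\leq^{*}$. Regular spaces are assumed to be $T_1$ (so regular means $T_3$, in particular Hausdorff). *)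

(* Defs.v *)
From HB Require Import structures.
From mathcomp Require Import all_boot all_order all_classical topology.
From mathcomp Require wochoice.

Set Implicit Arguments.
Unset Strict Implicit.
Unset Printing Implicit Defensive.

Import Order.TTheory.

Local Open Scope classical_set_scope.
Local Open Scope card_scope.

(* An ordinal is represented by any well-ordered [orderType] of that order
   type, and a cardinal by any [Type] of that cardinality. *)
Definition countable_ordinal d (W : orderType d) : Prop :=
  wochoice.well_order (<=%O : rel W) /\ countable [set: W].

(* [W] with a new greatest element [None]; omega + 1 is [ordinal_succ nat]. *)
Definition ordinal_succ (W : Type) : Type := option W.

Section SuccessorOrder.
Context {d : Order.disp_t} {W : orderType d}.

Definition ordinal_succ_le (x y : ordinal_succ W) : bool :=
  match x, y with
  | _, None => true
  | None, Some _ => false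
  | Some a, Some b => (a <= b)%O
  end.

Lemma ordinal_succ_le_refl : reflexive ordinal_succ_le.
Proof. by case=> [a|] //=. Qed.

Lemma ordinal_succ_le_anti : antisymmetric ordinal_succ_le.
Proof. by case=> [a|] [b|] //= /le_anti ->. Qed.

Lemma ordinal_succ_le_trans : transitive ordinal_succ_le.
Proof. by move=> [b|] [a|] [c|] //=; exact: le_trans. Qed.

Lemma ordinal_succ_le_total : total ordinal_succ_le.
Proof. by case=> [a|] [b|] //=; exact: le_total. Qed.

HB.instance Definition _ := Choice.copy (ordinal_succ W) (option W).
HB.instance Definition _ := Order.Le_isPOrder.Build d (ordinal_succ W)
  ordinal_succ_le_refl ordinal_succ_le_anti ordinal_succ_le_trans.
HB.instance Definition _ := Order.POrder_isTotal.Build d (ordinal_succ W)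
  ordinal_succ_le_total.

End SuccessorOrder.

Definition homeomorphic (S T : topologicalType) : Prop :=
  exists (f : S -> T) (g : T -> S),
    [/\ cancel f g, cancel g f, continuous f & continuous g].

(* X -> (top W)^1_kappa.  The type [set_type Y] of the elements of [Y] carries
   the subspace topology. *)
Definition arrow_top (X : topologicalType) d (W : orderType d)
    (kappa : Type) : Prop :=
  forall f : X -> kappa, exists (eta : kappa) (Y : set X),
    Y `<=` f @^-1` [set eta] /\
    homeomorphic (set_type Y) (order_topology W).

Definition card_lt T U (A : set T) (B : set U) : bool :=
  (A #<= B) && (A #!= B).

Lemma injective_card_le (T U : Type) (f : T -> U) :
  injective f -> [set: T] #<= [set: U].
Proof.
move=> fI; apply: card_le_trans (card_leT (f @` setT)).
by have /card_eqPle[] := inj_card_eq (A := setT) (fun x y _ _ e => fI x y e).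
Qed.

(* A maximal set of sections of [T] that pairwise differ in every coordinate
   projects onto some [T i], and [T i] then embeds in every [T j]. *)
Lemma card_family_min (I : Type) (T : I -> Type) (i0 : I) :
  exists i, forall j, [set: T i] #<= [set: T j].
Proof.
pose P : set (set (forall i, T i)) := [set F | forall f g, F f -> F g ->
   forall i, f i = g i -> f = g].
have [|F [PF maxF]] := @Zorn_bigcup _ P.
  move=> C CP totC f g [A CA Af] [B CB Bg].
  by case: (totC A B CA CB) => AB; [apply: (CP B)|apply: (CP A)] => //; apply: AB.
have [[i hi]|noi] := pselect (exists i, forall x : T i, exists2 f, F f & f i = x).
  exists i => j.
  pose s x := sval (cid2 (hi x)).
  have sF x : F (s x) by rewrite /s; case: cid2.
  have sE x : s x i = x by rewrite /s; case: cid2.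
  apply: (@injective_card_le _ _ (fun x => s x j)) => x y e.
  by rewrite -(sE x) -(sE y) (PF _ _ (sF x) (sF y) j e).
have ex i : exists x : T i, ~ exists2 f, F f & f i = x.
  apply: contrapT => /forallNP h; apply: noi; exists i => x.
  exact: contrapT (h x).
pose g i := sval (cid (ex i)).
have gN i f : F f -> f i <> g i.
  by rewrite /g; case: cid => x hx /= Ff e; apply: hx; exists f.
exfalso; apply: (maxF (F `|` [set g])).
  split; first by move=> ?; left.
  by move=> /(_ g (or_intror erefl)) Fg; exact: (gN i0 g Fg).
move=> f h [Ff|->] [Fh|->] i e //.
- exact: PF e.
- by case: (gN _ _ Ff e).
- by case: (gN _ _ Fh (esym e)).
Qed.

Lemma card_set_type (T : Type) (B : set T) : [set: set_type B] #= B.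
Proof.
have BE : set_val @` [set: set_type B] = B.
  rewrite eqEsubset; split=> [_ [x _ <-]|x Bx]; first exact: set_valP.
  by exists (SigSub (mem_set Bx)).
rewrite -[X in _ #= X]BE card_eq_sym.
by apply: inj_card_eq => x y _ _; exact: val_inj.
Qed.

Definition least_cardinal (P : Type -> Prop) (K : Type) : Prop :=
  P K /\ forall L : Type, P L -> [set: K] #<= [set: L].

Lemma least_cardinal_ex (P : Type -> Prop) :
  (exists K, P K) -> exists K, least_cardinal P K.
Proof.
move=> [K PK].
pose I := {A : set K | exists L, P L /\ A #= [set: L]}.
have K_I : exists L, P L /\ [set: K] #= [set: L] by exists K.
have [[A [L [PL AL]]] /= Amin] :=
  @card_family_min I (fun A => set_type (sval A)) (exist _ _ K_I).
exists L; split=> // M PM.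
have [[] Kmin] := @card_family_min bool (fun c => if c then M else K) true.
  have /card_leP[f] := Kmin false.
  pose B := (set_val \o f) @` [set: set_type [set: M]].
  have BM : B #= [set: M].
    apply: card_eq_trans (card_set_type [set: M]).
    by apply: inj_card_eq => x y xM yM /val_inj; exact: inj.
  have := Amin (exist _ B (ex_intro _ M (conj PM BM))) => /=.
  rewrite (card_le_eql (card_set_type A)) (card_le_eqr (card_set_type B)).
  by rewrite (card_le_eql AL) (card_le_eqr BM).
rewrite -(card_le_eql AL); exact: card_le_trans (card_leT A) (Kmin true).
Qed.

Definition nbhs_base (X : topologicalType) (x : X) (B : set (set X)) : Prop :=
  B `<=` nbhs x /\ filter_from B id --> x.

Definition is_character (X : topologicalType) : Type -> Prop :=
  least_cardinal (fun K => infinite_set [set: K] /\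
    forall x : X, exists B : set (set X), nbhs_base x B /\ B #<= [set: K]).

Lemma is_character_ex (X : topologicalType) : exists K, is_character X K.
Proof.
apply: least_cardinal_ex; exists (nat + set X)%type; split.
  move=> fin; apply: infinite_nat; apply: card_le_finite fin.
  by apply: (@injective_card_le _ _ inl) => m n [].
move=> x; exists (nbhs x : set (set X)); split.
  by split=> // U xU; exists U.
apply: card_le_trans (card_leT _) _.
by apply: (@injective_card_le _ _ inr) => A B [].
Qed.

Definition character (X : topologicalType) : Type :=
  sval (cid (is_character_ex X)).

Lemma characterP (X : topologicalType) : is_character X (character X).
Proof. by rewrite /character; case: cid. Qed.

Definition eventually_le (f g : nat -> nat) : Prop :=
  \forall n \near \oo, (f n <= g n)%N.

Definition unbounded_family (F : set (nat -> nat)) : Prop :=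
  ~ exists g : nat -> nat, forall f, F f -> eventually_le f g.

Definition is_bounding_number : Type -> Prop :=
  least_cardinal (fun K => exists F : set (nat -> nat),
    unbounded_family F /\ F #= [set: K]).

Lemma is_bounding_number_ex : exists b, is_bounding_number b.
Proof.
apply: least_cardinal_ex; exists (nat -> nat), setT; split=> //.
case=> g /(_ (fun n => (g n).+1) I) [N _ /(_ N)] /= /(_ (leqnn N)).
by rewrite ltnn.
Qed.

Definition bounding_number : Type := sval (cid is_bounding_number_ex).

Lemma bounding_numberP : is_bounding_number bounding_number.
Proof. by rewrite /bounding_number; case: cid. Qed.

(* Main.v *)
(* Call a set small if it is a countable union of sets containing no nontrivial
   convergent sequence together with its limit; the hypothesis on omega + 1 says
   that X is not small, so some colour class is not small either.  For a point w
   of the ordinal and any A, the set of x in A to which a sequence of copies of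
   [0, w] inside A converges misses only a small part of A, by induction on w:
   if the missing part B were not small, it would contain a sequence y_n -> x of
   points that are limits, within B, of copies of [0, p n], with p n cofinal in
   w.  Each y_n supplies a sequence of copies; since there are fewer than b basic
   neighbourhoods of x, one function n |-> k(n) chooses a copy for each y_n so
   that the chosen copies converge to x.  A copy of [0, w] with w sent to x is
   then obtained by putting the block (p (n-1), p n] on the (n+m)-th copy, and
   m -> oo makes these converge to x: so x is not in the missing part. *)
Require Import Defs.
From mathcomp Require Import all_boot all_order all_classical topology.
From mathcomp Require Import interval.
From mathcomp Require wochoice.

Set Implicit Arguments.
Unset Strict Implicit.
Unset Printing Implicit Defensive.

Import Order.TTheory.

Local Open Scope classical_set_scope.
Local Open Scope card_scope.

Lemma filter_forall_ltn (T : Type) (F : set_system T) (FF : Filter F)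
    (P : nat -> set T) (n : nat) :
  (forall j, (j < n)%N -> F (P j)) -> F [set t | forall j, (j < n)%N -> P j t].
Proof.
elim: n => [|n IHn] FP; first by apply: filterE.
have Fn := FP n (ltnSn n).
have {IHn}Flt := IHn (fun j jn => FP j (ltnW jn)).
apply: filterS (filterI Fn Flt) => t [Pn Plt] j.
by rewrite ltnS leq_eqVlt => /predU1P[->//|/Plt].
Qed.

(** * Separating the terms of a convergent sequence from each other and from the limit *)

Section Separation.
Variable X : topologicalType.

Lemma regular_accessible_hausdorff :
  accessible_space X -> regular_space X -> hausdorff_space X.
Proof.
move=> X1 Xreg x y xy; apply: contrapT => /eqP xNy.
have : nbhs x (~` [set y]).
  apply: open_nbhs_nbhs; split; last by move=> /= e; rewrite e eqxx in xNy.
  by apply: closed_openC; exact: accessible_closed_set1.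
move=> /Xreg[U xU Uy]; apply: (Uy y) => // V yV.
exact: xy xU yV.
Qed.

Hypothesis X2 : hausdorff_space X.

Lemma hausdorff_nbhs_setC (x y : X) : x != y ->
  exists2 G, nbhs x G & nbhs y (~` G).
Proof.
move: X2; rewrite open_hausdorff => /[apply] -[[A B] [xA yB] [oA oB /eqP AB]].
rewrite /= !inE in xA yB AB *; exists A; first exact: open_nbhs_nbhs.
apply: filterS (open_nbhs_nbhs (conj oB yB)) => t Bt At.
by have : (A `&` B) t by []; rewrite AB.
Qed.

(** A neighbourhood of [y n] whose complement is a neighbourhood of [x] already avoids all but
    finitely many terms; the finitely many others are cut off one at a time. *)
Lemma cvg_separate_term (x : X) (y : nat -> X) : injective y ->
  (forall n, y n != x) -> y n @[n --> \oo] --> x ->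
  forall n, exists G, [/\ nbhs (y n) G, nbhs x (~` G) &
    forall m, m != n -> nbhs (y m) (~` G)].
Proof.
move=> yI yx cy n; have [G0 nG0 xG0] := hausdorff_nbhs_setC (yx n).
have [N _ NG0] : \forall m \near \oo, nbhs (y m) (~` G0).
  exact: cy (nbhs_interior xG0).
have /choice[G1 G1P] : forall m, exists G : set X, nbhs (y n) G /\
    (m != n -> nbhs (y m) (~` G)).
  move=> m; have [->|mn] := eqVneq m n.
    by exists setT; split => //; exact: filterT.
  have [|G] := @hausdorff_nbhs_setC (y n) (y m); last by exists G.
  by apply: contra_neq mn => /yI.
exists (G0 `&` [set t | forall m, (m < N)%N -> G1 m t]); split.
- by apply: filterI => //; apply: filter_forall_ltn => m _; case: (G1P m).
- by apply: filterS xG0 => t G0t [].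
- move=> m mn; have [/NG0|mN] := leqP N m.
    by apply: filterS => t G0t [].
  have [_ /(_ mn)] := G1P m; apply: filterS => t G1t [_ /(_ m mN)].
  exact: G1t.
Qed.

(** Removing from the [n]-th separating set all earlier ones makes the sets disjoint; only finitely
    many are removed, each from around a point that it avoids. *)
Lemma cvg_disjoint_nbhs (x : X) (y : nat -> X) : injective y ->
  (forall n, y n != x) -> y n @[n --> \oo] --> x ->
  exists G : nat -> set X, [/\ forall n, open (G n), forall n, G n (y n),
    forall n, nbhs x (~` G n) & forall m n t, G m t -> G n t -> m = n].
Proof.
move=> yI yx cy.
have [G0 G0P] := choice (cvg_separate_term yI yx cy).
pose G1 n := G0 n `&` [set t | forall m, (m < n)%N -> (~` G0 m) t].
exists (fun n => (G1 n)°); split.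
- by move=> n; exact: open_interior.
- move=> n; apply: filterI; first by case: (G0P n).
  apply: filter_forall_ltn => m mn; case: (G0P m) => _ _; apply.
  by rewrite gtn_eqF.
- move=> n; case: (G0P n) => _ + _; apply: filterS => t G0t.
  by move=> /interior_subset[].
- move=> m n t /interior_subset Gm /interior_subset Gn.
  have [mn|nm|//] := ltngtP m n.
    by case: Gn => _ /(_ m mn); case: Gm.
  by case: Gm => _ /(_ n nm); case: Gn.
Qed.

End Separation.

(** * The ideal of small sets *)

Section Small.
Variable X : topologicalType.

Definition contains_cvg (F : set X) : Prop :=
  exists (x : X) (y : nat -> X), [/\ F x, forall n, F (y n), injective y,
    forall n, y n != x & y n @[n --> \oo] --> x].

Definition small (A : set X) : Prop :=
  exists F : nat -> set X, A `<=` \bigcup_n F n /\ forall n, ~ contains_cvg (F n).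

Lemma small0 : small set0.
Proof. by exists (fun=> set0); split => // n [x [y []]]. Qed.

Lemma sub_small (A B : set X) : A `<=` B -> small B -> small A.
Proof. by move=> AB [F [BF FN]]; exists F; split => // x /AB /BF. Qed.

Lemma not_small_cvg (A : set X) : ~ small A -> contains_cvg A.
Proof.
move=> As; apply: contrapT => NA; apply: As; exists (fun=> A); split => // x Ax.
by exists 0%N.
Qed.

Lemma small_bigcup (A : nat -> set X) : (forall n, small (A n)) ->
  small (\bigcup_n A n).
Proof.
move=> /choice[F FP].
exists (fun k => if unpickle k is Some (i, j) then F i j else set0); split.
  move=> x [i _ /(proj1 (FP i))[j _ Fx]].
  by exists (pickle (i, j)); rewrite //= pickleK.
move=> n; case: (unpickle n) => [[i j]|]; first exact: (proj2 (FP i)).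
by case=> x [y []].
Qed.

Lemma small_setU (A B : set X) : small A -> small B -> small (A `|` B).
Proof.
move=> As Bs; have := @small_bigcup (fun n => if n is 0%N then A else B).
move=> /(_ _)/sub_small; apply; last by case.
by move=> x [Ax|Bx]; [exists 0%N|exists 1%N].
Qed.

Lemma cvg_Some_None :
  (Some n : order_topology (ordinal_succ nat)) @[n --> \oo]
    --> (None : order_topology (ordinal_succ nat)).
Proof.
move=> U; rewrite order_nbhs_itv => -[[l r] [io Ni] iU].
suff [N NP] : exists N, forall n, (N <= n)%N ->
    [set` Interval l r] (Some n : order_topology (ordinal_succ nat)).
  by exists N => // n /= /NP ?; apply: iU.
case: l io Ni {iU} => [a [v|]|a]; case: r => [b [w|]|b]; case: a; case: b.
all: rewrite /itv_open_ends ?in_itv /= ?in_itv //=.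
- move=> _ _; exists v.+1 => n vn; rewrite in_itv /= andbT lt_neqAle.
  by apply/andP; split; [apply/eqP => -[nv]; rewrite nv ltnn in vn|exact: ltnW vn].
- by move=> _ _; exists 0%N => n _; rewrite in_itv.
Qed.

(** Colour each point by the index of a piece containing it: a monochromatic copy of omega + 1 is a
    convergent sequence with its limit inside one piece. *)
Lemma arrow_omega1_not_small :
  arrow_top X (ordinal_succ nat) nat -> ~ small [set: X].
Proof.
move=> arX [F [TF NF]].
have /choice[f fF] : forall x, exists n, F n x.
  by move=> x; have [n _ Fx] := TF x I; exists n.
have [n [Y [Yn [phi [g [phiK gK _ gc]]]]]] := arX f.
apply: (NF n); pose h t := set_val (g t).
have Fh t : F n (h t).
  have : f (h t) = n by apply: Yn; exact: set_valP.
  by move<-.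
have hI : injective h by move=> s t /val_inj /(can_inj gK).
exists (h None), (fun k => h (Some k)); split => //.
- by move=> i j /hI [].
- by move=> i; apply/eqP => /hI.
- have hc : continuous h.
    by move=> t; apply: continuous_comp; [exact: gc|exact: initial_continuous].
  exact: cvg_comp cvg_Some_None (hc None).
Qed.

End Small.

(** * Diagonal choice of indices below the bounding number *)

Section Bounding.
Variable X : topologicalType.
Hypothesis chi_lt_b : card_lt [set: character X] [set: bounding_number].

Lemma bounded_family (T : Type) (F : set T) (f : T -> nat -> nat) :
  F #<= [set: character X] ->
  exists g, forall t, F t -> eventually_le (f t) g.
Proof.
move=> Fchi; apply: contrapT => Nb.
have unb : unbounded_family (f @` F).
  by move=> [g gP]; apply: Nb; exists g => t Ft; apply: gP; exists t.
have [_ bmin] := bounding_numberP.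
have : [set: bounding_number] #<= [set: character X].
  have := bmin (set_type (f @` F)) _.
  move=> /(_ (ex_intro _ _ (conj unb _))).
  rewrite (card_le_eqr (card_set_type _)) card_eq_sym => /(_ (card_set_type _)).
  move=> /card_le_trans; apply; apply: card_le_trans Fchi; exact: card_image_le.
case/andP: chi_lt_b => le_chi_b /negP ne_chi_b ge_chi_b; apply: ne_chi_b.
by rewrite card_eq_le le_chi_b.
Qed.

(** Each basic neighbourhood [U] of [x] yields a function giving, for every [n], a threshold past
    which [K n k] lies in [U]. There are fewer than b such functions, so one [g] eventually
    dominates them all. *)
Lemma uniformize_cvg (x : X) (K : nat -> nat -> set X) :
  (forall U, nbhs x U ->
    \forall n \near \oo, \forall k \near \oo, K n k `<=` U) ->
  exists g : nat -> nat, forall U, nbhs x U ->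
    \forall n \near \oo, forall k, (g n <= k)%N -> K n k `<=` U.
Proof.
move=> KP; have [[_ /(_ x)[B [[Bx Bbase] Bchi]]] _] := characterP X.
have /choice[f fP] : forall U : set X, exists f : nat -> nat, forall n,
    (\forall k \near \oo, K n k `<=` U) -> forall k, (f n <= k)%N -> K n k `<=` U.
  move=> U.
  suff /choice[f fP] : forall n, exists m, (\forall k \near \oo, K n k `<=` U) ->
    forall k, (m <= k)%N -> K n k `<=` U by exists f.
  move=> n.
  have [[m _ mP]|NK] := pselect (\forall k \near \oo, K n k `<=` U).
    by exists m => _ k; exact: mP.
  (* Where no threshold exists the value is arbitrary; for a neighbourhood of [x] this concerns only
     finitely many [n]. *)
  by exists 0%N.
have [g gP] := bounded_family f Bchi.
exists g => U /Bbase[V BV VU].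
have := gP V BV; have := KP V (Bx V BV); apply: filterS2 => n KV fg k gk.
by apply: subset_trans VU; apply: fP => //; exact: leq_trans gk.
Qed.

End Bounding.

(** * The order topology of a well-order *)

Section WellOrder.
Context {d : Order.disp_t} {W : orderType d}.
Hypothesis Wwo : wochoice.well_order (<=%O : rel W).

Lemma well_order_least (P : W -> Prop) : (exists w, P w) ->
  exists2 w, P w & forall v, P v -> (w <= v)%O.
Proof.
move=> [w Pw]; have [|z [[Pz zP] _]] := Wwo (A := [pred v | `[< P v >]]).
  by exists w; rewrite inE.
exists z; first by rewrite inE in Pz.
by move=> v Pv; apply: zP; rewrite inE.
Qed.

Lemma well_order_ind (P : W -> Prop) :
  (forall w, (forall v, (v < w)%O -> P v) -> P w) -> forall w, P w.
Proof.
move=> IH w; apply: contrapT => Pw.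
have [|z Pz zP] := @well_order_least (fun v => ~ P v); first by exists w.
apply: Pz; apply: IH => v vz; apply: contrapT => /zP.
by rewrite leNgt vz.
Qed.

Lemma nbhs_gt (u v : W) : (v < u)%O ->
  nbhs (u : order_topology W) [set z | (v < z)%O].
Proof.
move=> vu; have := @rray_open _ (order_topology W) v.
rewrite openE => /(_ u); rewrite /= in_itv /= andbT => /(_ vu).
by apply: filterS => z /=; rewrite in_itv /= andbT.
Qed.

(** Either [v] is the greatest point, or the set is the open ray below the successor of [v]. *)
Lemma nbhs_le (u v : W) : (u <= v)%O ->
  nbhs (u : order_topology W) [set z | (z <= v)%O].
Proof.
move=> uv; have [[w0 vw0]|vtop] := pselect (exists w, (v < w)%O); last first.
  apply: filterE => z /=; rewrite leNgt; apply/negP => vz.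
  by apply: vtop; exists z.
have [|w vw wP] := @well_order_least (fun w => (v < w)%O); first by exists w0.
have := @lray_open _ (order_topology W) w.
rewrite openE => /(_ u); rewrite /= in_itv /= => /(_ (le_lt_trans uv vw)).
apply: filterS => z /=; rewrite in_itv /= => zw.
by rewrite leNgt; apply/negP => /wP; rewrite leNgt zw.
Qed.

Lemma nbhs_lt_sub (u : W) (J : set W) : nbhs (u : order_topology W) J ->
  (forall z, (z <= u)%O -> J z) \/
  exists2 v, (v < u)%O & forall z, (v < z <= u)%O -> J z.
Proof.
rewrite order_nbhs_itv => -[[l r] [io ui] iJ].
case: l io ui iJ => [a v|a] io ui iJ; [right|left].
- case: a io ui iJ => io ui iJ; first by case: r io {ui iJ} => [[] ?|[]].
  move: ui; rewrite itv_boundlr => /andP[]; rewrite bnd_simp => vu ur.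
  exists v => // z /andP[vz zu]; apply: iJ; rewrite /= itv_boundlr bnd_simp vz /=.
  exact: le_trans ur.
- case: a io ui iJ => io ui iJ; last by case: r io {ui iJ} => [[] ?|[]].
  move: ui; rewrite itv_boundlr => /andP[_ ur] z zu; apply: iJ.
  rewrite /= itv_boundlr /=; exact: le_trans ur.
Qed.

End WellOrder.

(** * Topological copies of subsets of the ordinal *)

Section Embedding.
Variable X : topologicalType.
Context {d : Order.disp_t} {W : orderType d}.
Hypothesis Wwo : wochoice.well_order (<=%O : rel W).

(** The two clauses are continuity at [u] of [e] restricted to [S] and of its inverse. Keeping [e]
    total on [W] avoids subspace types when copies are cut and glued; injectivity on [S] is a
    consequence. *)
Definition embeds_on (S : set W) (e : W -> X) : Prop :=
  forall u, S u ->
    (forall U, nbhs (e u) U ->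
       nbhs (u : order_topology W) [set z | S z -> U (e z)]) /\
    (forall J, nbhs (u : order_topology W) J ->
       exists2 U, nbhs (e u) U & forall z, S z -> U (e z) -> J z).

Lemma embeds_on_inj (S : set W) (e : W -> X) (u z : W) :
  embeds_on S e -> S u -> S z -> e u = e z -> u = z.
Proof.
move=> eS Su Sz; wlog uz : u z Su Sz / (u <= z)%O.
  by move=> WH; have [/WH|/WH h /esym/h] := orP (le_total u z); [exact|move->].
move=> euz; apply/le_anti; rewrite uz /=.
have [U eU UP] := (eS u Su).2 _ (nbhs_le Wwo (lexx u)).
by apply: (UP z Sz); rewrite -euz; exact: nbhs_singleton.
Qed.

Lemma embeds_on_homeomorphic (e : W -> X) : embeds_on setT e ->
  homeomorphic (set_type (range e)) (order_topology W).
Proof.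
move=> eT; have /choice[f fP] : forall t : set_type (range e),
    exists w, e w = set_val t.
  by move=> t; have [w _ ewt] := set_valP t; exists w.
pose g (w : order_topology W) : set_type (range e) :=
  SigSub (mem_set (imageT e w)).
have gE w : set_val (g w) = e w by [].
exists f, g; split.
- by move=> t; apply: val_inj; exact: fP.
- by move=> w; apply: (embeds_on_inj eT) => //; exact: fP.
- move=> t J; rewrite /= => tJ; have [_ /(_ J tJ)[U eU UP]] := eT (f t) I.
  rewrite fP in eU.
  have tU : nbhs t [set s : set_type (range e) | U (set_val s)].
    exact: (@initial_continuous _ _ (set_val : set_type (range e) -> X)) eU.
  suff : nbhs t (f @^-1` J) by [].
  by apply: filterS tU => s /= Us; apply: UP => //; rewrite fP.
- apply: (@continuous_comp_initial _ _ _ (set_val : set_type (range e) -> X)).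
  move=> w U /(eT w I).1; apply: filterS => z /= h; exact: h.
Qed.

(** Convergence is that of whole copies: the entire [k]-th image of [S] enters each neighbourhood of
    [x]. The copies need not contain [x]. *)
Definition limit_copies (S : set W) (A : set X) : set X :=
  [set x | A x /\ exists e : nat -> W -> X,
    [/\ forall k, embeds_on S (e k), forall k z, S z -> A (e k z) &
        forall U, nbhs x U -> \forall k \near \oo, forall z, S z -> U (e k z)]].

(** * Gluing copies of initial segments along a convergent sequence *)

Section Glue.
Variables (S : set W) (p : nat -> W).
Hypothesis p_homo : {homo p : m n / (m <= n)%N >-> (m <= n)%O}.
Hypothesis S_top : forall u, S u -> (forall n, (p n < u)%O) ->
  forall v, (v < u)%O -> exists n, (v <= p n)%O.
Variables (x : X) (G : nat -> set X) (c : nat -> W -> X).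
Hypothesis G_open : forall n, open (G n).
Hypothesis G_far : forall n, nbhs x (~` G n).
Hypothesis G_disj : forall m n t, G m t -> G n t -> m = n.
Hypothesis c_emb : forall n, embeds_on [set z | (z <= p n)%O] (c n).
Hypothesis c_G : forall n z, (z <= p n)%O -> G n (c n z).
Hypothesis c_cvg : forall U, nbhs x U ->
  \forall n \near \oo, forall z, (z <= p n)%O -> U (c n z).

(** The block (p (n-1), p n], possibly empty, as [p] is only weakly increasing. The blocks are open
    and disjoint, and by [S_top] at most one point of [S] lies above them all. *)
Let I (n : nat) : set W :=
  [set z | (z <= p n)%O /\ forall m, (m < n)%N -> (p m < z)%O].

Let I_total z : (exists n, I n z) \/ forall n, (p n < z)%O.
Proof.
have [[n zn]|Nz] := pselect (exists n, (z <= p n)%O); [left|right].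
  have exn : exists n, (z <= p n)%O by exists n.
  case: (ex_minnP exn) => k zk kmin; exists k; split => // m mk.
  by rewrite ltNge; apply/negP => /kmin; rewrite leqNgt mk.
by move=> n; rewrite ltNge; apply/negP => zn; apply: Nz; exists n.
Qed.

Let I_inj z m n : I m z -> I n z -> m = n.
Proof.
move=> [zm Im] [zn In]; case: (ltngtP m n) => // [/In|/Im].
  by rewrite ltNge zm.
by rewrite ltNge zn.
Qed.

Let I_nbhs u n : I n u -> nbhs (u : order_topology W) (I n).
Proof.
move=> [un In]; apply: filterI; first exact: nbhs_le.
by apply: filter_forall_ltn => m mn; apply: nbhs_gt; exact: In.
Qed.

(* The [m]-th copy puts the block [I n] on the copy near the [(n+m)]-th term of
   the sequence and the remaining point of [S], if any, on its limit [x]. *)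
Let e (m : nat) (u : W) : X :=
  if pselect (exists n, I n u) is left h then c (sval (cid h) + m)%N u else x.

Let eI m n u : I n u -> e m u = c (n + m)%N u.
Proof.
move=> In; rewrite /e; case: pselect => [h|[]]; last by exists n.
by case: cid => k /= Ik; rewrite (I_inj Ik In).
Qed.

Let eN m u : (forall n, (p n < u)%O) -> e m u = x.
Proof.
move=> Nu; rewrite /e; case: pselect => [h|//]; exfalso; case: h => n [un _].
by move: (Nu n); rewrite ltNge un.
Qed.

Let I_le m n z : I n z -> (z <= p (n + m)%N)%O.
Proof. by move=> [zn _]; apply: le_trans zn (p_homo _); exact: leq_addr. Qed.

(** Inside a block both clauses are inherited from the copy used there, since blocks are open in [W]
    and different copies lie in disjoint open sets. At the remaining point, continuity comes from
    [c_cvg] and openness from avoiding finitely many [G j]. *)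
Let e_emb m : embeds_on S (e m).
Proof.
move=> u Su; have [[n In]|Nu] := I_total u.
  have [cc co] := c_emb (I_le m In : [set z | (z <= p (n + m)%N)%O] u).
  rewrite (eI m In); split=> [U /cc cU|J /co[U cU UJ]].
    apply: filterS (filterI cU (I_nbhs In)) => z [Uz Iz] Sz.
    by rewrite (eI m Iz); apply: Uz; exact: I_le Iz.
  (* The factor [G (n + m)] forces [z] into the block of [u]. *)
  exists (U `&` G (n + m)%N).
    apply: filterI => //; apply: open_nbhs_nbhs; split; first exact: G_open.
    by apply: c_G; exact: I_le In.
  move=> z Sz; have [[k Ik]|Nz] := I_total z.
    rewrite (eI m Ik) => -[Uz Gz].
    have /(G_disj Gz)/addIn kn : G (k + m)%N (c (k + m)%N z).
      by apply: c_G; exact: I_le Ik.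
    rewrite -kn in Uz Ik; apply: UJ Uz; exact: I_le Ik.
  by rewrite (eN m Nz) => -[_ Gx]; have /nbhs_singleton := G_far (n + m)%N.
rewrite (eN m Nu); split=> [U xU|J uJ].
  (* A point above [p M] lies in a block of index greater than [M], or in none. *)
  have [M _ MP] := c_cvg xU; apply: filterS (nbhs_gt (Nu M)) => z Mz Sz.
  have [[k Ik]|Nz] := I_total z; last first.
    by rewrite (eN m Nz); exact: nbhs_singleton.
  rewrite (eI m Ik); apply: MP; last exact: I_le Ik.
  apply: leq_trans (leq_addr _ _); rewrite leqNgt; apply/negP => kM.
  have := lt_le_trans Mz Ik.1; rewrite ltNge => /negP; apply.
  exact/p_homo/ltnW.
have [n nJ] : exists n, forall z, S z -> (p n < z)%O -> J z.
  have le_u z : S z -> (z <= u)%O.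
    move=> Sz; rewrite leNgt; apply/negP => uz.
    have [n un] := S_top Sz (fun n => lt_trans (Nu n) uz) uz.
    by move: (Nu n); rewrite ltNge un.
  have [uJ0|[v vu vJ]] := nbhs_lt_sub uJ.
    by exists 0%N => z /le_u zu _; exact: uJ0.
  have [n vn] := S_top Su Nu vu; exists n => z Sz nz; apply: vJ.
  by rewrite (le_lt_trans vn nz) le_u.
(* Block [k] is sent into [G (k + m)], so avoiding every [G j] with [j] up to and including [n + m]
   leaves only blocks beyond [n]. *)
exists [set t | forall j, (j < (n + m).+1)%N -> (~` G j) t].
  by apply: filter_forall_ltn => j _; exact: G_far.
move=> z Sz Gz; have [[k Ik]|Nz] := I_total z; apply: nJ => //.
apply: Ik.2; rewrite ltnNge; apply/negP => kn.
apply: (Gz (k + m)%N); first by rewrite ltnS leq_add2r.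
by rewrite (eI m Ik); apply: c_G; exact: I_le Ik.
Qed.

(** The [m]-th glued copy uses only terms of index at least [m], besides [x] itself, so whole copies
    converge to [x]. *)
Lemma glue_limit_copies (A : set X) : A x ->
  (forall n z, (z <= p n)%O -> A (c n z)) -> limit_copies S A x.
Proof.
move=> Ax cA; split => //; exists e; split => [|m z Sz|U xU].
- exact: e_emb.
- have [[k Ik]|Nz] := I_total z; last by rewrite (eN m Nz).
  by rewrite (eI m Ik); apply: cA; exact: I_le Ik.
- have [M _ MP] := c_cvg xU; exists M => // m Mm z Sz.
  have [[k Ik]|Nz] := I_total z; last first.
    by rewrite (eN m Nz); exact: nbhs_singleton.
  rewrite (eI m Ik); apply: MP; last exact: I_le Ik.
  exact: leq_trans (leq_addl _ _).
Qed.

End Glue.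

(** * Transfinite induction: points that are not limits of copies form a small set *)

Lemma limit_copies_least (w : W) (A : set X) : (forall v, (w <= v)%O) ->
  A `<=` limit_copies [set z | (z <= w)%O] A.
Proof.
move=> wmin x Ax; split => //; exists (fun _ _ => x); split => //.
- move=> k u /= uw; split=> [U xU|J uJ].
    by apply: filterE => z _; exact: nbhs_singleton.
  exists setT => [|z zw _]; first exact: filterT.
  have -> : z = u by apply/le_anti; rewrite (le_trans zw) ?(le_trans uw) ?wmin.
  exact: nbhs_singleton uJ.
- by move=> U xU; near=> k => z _; exact: nbhs_singleton.
Unshelve. all: by end_near. Qed.

Hypothesis X2 : hausdorff_space X.
Hypothesis chi_lt_b : card_lt [set: character X] [set: bounding_number].

(** A general [S] covers both uses: [0, w] with [p] cofinal below [w], and all of [W]. Smallness is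
    assumed for every [B] because it is applied to the missing part of [A], not to [A]. *)
Lemma small_setD_limit_copies (S : set W) (p : nat -> W) (A : set X) :
  {homo p : m n / (m <= n)%N >-> (m <= n)%O} ->
  (forall u, S u -> (forall n, (p n < u)%O) ->
     forall v, (v < u)%O -> exists n, (v <= p n)%O) ->
  (forall n B, small (B `\` limit_copies [set z | (z <= p n)%O] B)) ->
  small (A `\` limit_copies S A).
Proof.
move=> p_homo S_top p_small; set B := A `\` _.
pose C := \bigcap_n limit_copies [set z | (z <= p n)%O] B.
apply: contrapT => NB.
(* The set [B] minus [C] is a countable union of small sets. *)
have /not_small_cvg[x [y [Cx Cy yI yx cy]]] : ~ small C.
  move=> Cs; apply: NB.
  apply: sub_small (small_setU Cs (small_bigcup (fun n => p_small n B))).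
  move=> t Bt; have [Ct|Ct] := pselect (C t); [by left|right].
  apply: contrapT => Nt; apply: Ct => n _; apply: contrapT => Nn.
  by apply: Nt; exists n.
have [Bx _] := Cx 0%N I.
have /choice[e eP] n := (Cy n n I).2.
pose K n k := e n k @` [set z | (z <= p n)%O].
have [g gP] : exists g : nat -> nat, forall U, nbhs x U ->
    \forall n \near \oo, forall k, (g n <= k)%N -> K n k `<=` U.
  apply: (uniformize_cvg chi_lt_b) => U xU.
  have := cy _ (nbhs_interior xU).
  rewrite nbhs_filterE /=; apply: filterS => n yU; have [_ _ /(_ U yU)] := eP n.
  by apply: filterS => k eU _ [z zn <-]; exact: eU.
have [G [Go Gy Gx GI]] := cvg_disjoint_nbhs X2 yI yx cy.
have /choice[h hP] n : exists m, forall k, (m <= k)%N ->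
    forall z, (z <= p n)%O -> G n (e n k z).
  have [_ _ /(_ (G n))[|m _ mP]] := eP n; last by exists m.
  by apply: open_nbhs_nbhs; split.
(* The bound [g] makes the chosen copies converge to [x]; [h] puts the [n]-th one inside [G n]. *)
pose c n := e n (maxn (g n) (h n)).
have [] : limit_copies S B x.
  apply: (glue_limit_copies p_homo S_top Go Gx GI (c := c)) => //.
  - by move=> n; have [+ _ _] := eP n; exact.
  - by move=> n z; apply: hP; exact: leq_maxr.
  - move=> U /gP; apply: filterS => n KU z zn.
    by apply: (KU _ (leq_maxl _ (h n))); exists z.
  - by move=> n z zn; have [_ + _] := eP n; exact.
(* Copies inside [B] are copies inside [A], whereas [x] in [B] is no limit of such copies. *)
move=> _ [E [E1 E2 E3]]; case: Bx => Ax; apply; split => //.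
by exists E; split => // k z /(E2 k)[].
Qed.

Hypothesis W_countable : countable [set: W].

Lemma countable_cofinal_seq (P : set W) (w0 : W) :
  P w0 -> exists p : nat -> W, [/\ {homo p : m n / (m <= n)%N >-> (m <= n)%O},
    forall n, P (p n) & forall v, P v -> exists n, (v <= p n)%O].
Proof.
move=> Pw0; have /countable_injP[f fI] := W_countable.
have /choice[s sP] : forall n, exists v,
    P v /\ forall u, P u -> f u = n -> u = v.
  move=> n; have [[v [Pv vn]]|Nn] := pselect (exists v, P v /\ f v = n).
    exists v; split => // u Pu un; apply: fI; rewrite ?inE //.
    by rewrite un.
  by exists w0; split => // u Pu un; case: Nn; exists u.
pose p := fix p n := if n is m.+1 then Order.max (p m) (s n) else s 0%N.
have sp n : (s n <= p n)%O by case: n => [|n] //=; rewrite le_max lexx orbT.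
exists p; split.
- by apply: homo_leq => [//|? ? ?|n /=]; [exact: le_trans|rewrite le_max lexx].
- elim=> [|n IHn] /=; first by case: (sP 0%N).
  by rewrite maxEle; case: ifP => // _; case: (sP n.+1).
- by move=> v Pv; exists (f v); rewrite {1}((sP (f v)).2 v Pv erefl).
Qed.

(** Successors and limits are treated alike: below a successor, [p] is eventually constant at the
    predecessor. *)
Lemma small_setD_limit_copies_le (w : W) (A : set X) :
  small (A `\` limit_copies [set z | (z <= w)%O] A).
Proof.
elim/(well_order_ind Wwo): w A => w IHw A.
have [[v0 v0w]|wmin] := pselect (exists v, (v < w)%O); last first.
  apply: sub_small (small0 X) => x [Ax]; apply; apply: limit_copies_least Ax => v.
  by rewrite leNgt; apply/negP => vw; apply: wmin; exists v.
have [p [p_homo pw p_cof]] := countable_cofinal_seq (P := [set v | (v < w)%O]) v0w.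
apply: (small_setD_limit_copies _ p_homo) => [u uw _ v vu|n B].
  by apply: p_cof; exact: lt_le_trans vu uw.
exact: (IHw (p n) (pw n)).
Qed.

Lemma embeds_of_not_small (A : set X) : ~ small A ->
  exists e : W -> X, embeds_on setT e /\ forall z, A (e z).
Proof.
move=> NA; have [[w0 _]|NW] := pselect (exists w : W, True); last first.
  have [x [_ [Ax _ _ _ _]]] := not_small_cvg NA.
  by exists (fun=> x); split => u; case: NW; exists u.
(* With [p] cofinal in all of [W], no point lies above every block, so [W] needs no greatest
   element. *)
have [p [p_homo _ p_cof]] := @countable_cofinal_seq setT w0 I.
have sD : small (A `\` limit_copies setT A).
  apply: (small_setD_limit_copies _ p_homo) => [u _ _ v _|n B]; first exact: p_cof.
  exact: small_setD_limit_copies_le.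
have [x [_ [e [eT eA _]]]] : exists x, limit_copies setT A x.
  apply: contrapT => NL; apply: NA; apply: sub_small sD => x Ax; split => // Lx.
  by apply: NL; exists x.
by exists (e 0%N); split => // z; exact: eA.
Qed.

End Embedding.

Theorem theorem1p2 (X : topologicalType)
    (X_T1 : accessible_space X) (X_regular : regular_space X)
    (X_omega1 : arrow_top X (ordinal_succ nat) nat)
    (chi_lt_b : card_lt [set: character X]%classic [set: bounding_number]%classic)
    (d : Order.disp_t) (W : orderType d) (W_countable : countable_ordinal W) :
  arrow_top X W nat.
Proof.
have [Wwo Wc] := W_countable => f.
have X2 := regular_accessible_hausdorff X_T1 X_regular.
have [n Nn] : exists n, ~ small (f @^-1` [set n]).
  apply/existsNP => sf; apply: (arrow_omega1_not_small X_omega1).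
  by apply: sub_small (small_bigcup sf) => x _; exists (f x).
have [e [eT en]] := embeds_of_not_small Wwo X2 chi_lt_b Wc Nn.
exists n, (range e); split; first by move=> _ [z _ <-]; exact: en.
exact: embeds_on_homeomorphic.
Qed.
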